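(* Let $f : X \to Y$ be a morphism of locally Noetherian normal schemes of finite type over a field $k$ of characteristic zero and let $\partial$ be a local derivation of the relative tangent sheaf $\mathscr{T}_{X/Y}$. Let $\mathrm{Fitt}_{r}(\Omega_{X/Y}^1)$ be the $r$-th Fitting ideal of $\Omega_{X/Y}^1$. Then $$\partial\bigl(\mathrm{Fitt}_{r}(\Omega_{X/Y}^1)\bigr) \subseteq \mathrm{Fitt}_{r}(\Omega_{X/Y}^1).$$
   Context: $\mathscr{T}_{X/Y}$ is the sheaf of $\mathscr{O}_Y$-linear derivations of $\mathscr{O}_X$; a local derivation is a section over an open subset of $X$. For a coherent sheaf with a local presentation $\mathscr{O}^{m}\to\mathscr{O}^{n}\to\mathscr{E}\to 0$, the ideal $\mathrm{Fitt}_r(\mathscr{E})$ is generated by the $(n-r)\times(n-r)$ minors of the presentation matrix. *)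

(* Defs.v *)
From HB Require Import structures.
From mathcomp Require Import all_boot all_order all_algebra.
From mathcomp Require Import boolp classical_sets topology.

Set Implicit Arguments.
Unset Strict Implicit.
Unset Printing Implicit Defensive.

Import GRing.Theory.
Local Open Scope quotient_scope.
Local Open Scope classical_set_scope.
Local Open Scope ring_scope.

(* Rings are [comPzRingType]: the zero ring must be allowed, since it is the
   ring of sections over the empty open set. *)

Section CommutativeAlgebra.
Variable A : comPzRingType.
Implicit Types (I J : set A) (G : set A).

Definition ideal I : Prop :=
  [/\ I 0, forall a b, I a -> I b -> I (a + b) & forall a b, I b -> I (a * b)].

Definition ideal_gen G : set A :=
  [set a | forall I, ideal I -> G `<=` I -> I a].

Definition prime_ideal I : Prop :=
  [/\ ideal I, ~ I 1 & forall a b, I (a * b) -> I a \/ I b].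

Definition maximal_ideal I : Prop :=
  [/\ ideal I, ~ I 1 & forall J, ideal J -> ~ J 1 -> I `<=` J -> J `<=` I].

Definition local_ring : Prop := exists! I, maximal_ideal I.

Definition noetherian_ring : Prop :=
  forall I, ideal I -> exists s : seq A, I = ideal_gen [set a | a \in s].

Definition subring (B : set A) : Prop :=
  [/\ B 1, forall a b, B a -> B b -> B (a - b)
    & forall a b, B a -> B b -> B (a * b)].

Definition is_unit (a : A) : Prop := exists b, b * a = 1.

(* The existential only serves to transfer [A] to the structure of integral
   domains, on which the library defines the field of fractions. *)
Definition normal_domain : Prop :=
  exists (R : idomainType) (theta : {rmorphism A -> R}), bijective theta /\
    forall z : {fraction R}, integralOver (@tofrac R) z ->
      exists a : R, z = tofrac a.

(* Submatrices with repeated rows or columns are excluded; reordering rows and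
   columns only changes the sign of a minor. *)
Definition minors m n (M : 'M[A]_(m, n)) (p : nat) : set A :=
  [set a | exists (f : 'I_p -> 'I_m) (g : 'I_p -> 'I_n),
     [/\ injective f, injective g & a = \det (mxsub f g M)]].

End CommutativeAlgebra.

Definition finite_type_hom (A B : comPzRingType) (phi : A -> B) : Prop :=
  exists s : seq B, forall C : set B, subring C ->
    range phi `<=` C -> [set b | b \in s] `<=` C -> C = setT.

(* [phi] identifies [B] with the localization of [A] at the powers of [g]. *)
Definition localization_away (A B : comPzRingType) (g : A) (phi : A -> B) :
    Prop :=
  [/\ is_unit (phi g),
      forall b, exists a n, b * phi g ^+ n = phi a
    & forall a, phi a = 0 -> exists n, g ^+ n * a = 0].

Record spec (R : comPzRingType) := Spec {
  spec_ideal :> set R;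
  spec_prime : prime_ideal spec_ideal }.

HB.instance Definition _ (R : comPzRingType) := gen_eqMixin (spec R).
HB.instance Definition _ (R : comPzRingType) := gen_choiceMixin (spec R).

Section Zariski.
Variable R : comPzRingType.

Definition basic_open (g : R) : set (spec R) := [set p | ~ spec_ideal p g].

Definition zariski_open (A : set (spec R)) : Prop :=
  exists E : set R, A = \bigcup_(g in E) basic_open g.

Lemma zariski_openT : zariski_open setT.
Proof.
exists [set 1]; apply/seteqP; split=> p // _.
by exists 1 => //; case: (spec_prime p).
Qed.

Lemma zariski_openI (A B : set (spec R)) :
  zariski_open A -> zariski_open B -> zariski_open (A `&` B).
Proof.
move=> [E ->] [F ->].
exists [set a | exists g h, [/\ E g, F h & a = g * h]].
apply/seteqP; split=> p /=.
  move=> [[g Eg pg] [h Fh ph]]; exists (g * h); first by exists g, h.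
  by case: (spec_prime p) => _ _ pp /pp [].
move=> [_ [g [h [Eg Fh ->]]]] pgh.
have [[_ _ pM] _ _] := spec_prime p.
split; [exists g => // pg | exists h => // ph]; apply: pgh; last exact: pM.
by rewrite mulrC; exact: pM.
Qed.

Lemma zariski_open_bigU (I : Type) (A : I -> set (spec R)) :
  (forall i, zariski_open (A i)) -> zariski_open (\bigcup_i A i).
Proof.
move=> /choice[E AE]; exists (\bigcup_i E i); apply/seteqP; split=> p.
  by move=> [i _]; rewrite AE => -[g Eg pg]; exists g => //; exists i.
by move=> [g [i _ Eg] pg]; exists i => //; rewrite AE; exists g.
Qed.

HB.instance Definition _ := isOpenTopological.Build (spec R)
  zariski_openT zariski_openI zariski_open_bigU.

End Zariski.

Record opens (X : topologicalType) := Opens {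
  open_set :> set X;
  open_setP : open open_set }.

Definition opensT (X : topologicalType) : opens X := Opens (@openT X).

Definition opensI (X : topologicalType) (U V : opens X) : opens X :=
  Opens (openI (open_setP U) (open_setP V)).

Lemma opensIl (X : topologicalType) (U V : opens X) : opensI U V `<=` U.
Proof. by move=> y []. Qed.

Lemma opensIr (X : topologicalType) (U V : opens X) : opensI U V `<=` V.
Proof. by move=> y []. Qed.

Lemma open_preimage (X Y : topologicalType) (f : X -> Y) (V : opens Y) :
  continuous f -> open (f @^-1` V).
Proof. by move=> /continuousP; apply; exact: open_setP. Qed.

Definition sheaf_axiom (X : topologicalType) (F : opens X -> Type)
    (res : forall U V : opens X, V `<=` U -> F U -> F V) : Prop :=
  forall (I : Type) (U : opens X) (V : I -> opens X)
      (VU : forall i, V i `<=` U),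
    U `<=` \bigcup_i V i ->
    forall s : forall i, F (V i),
      (forall i j (W : opens X) (Wi : W `<=` V i) (Wj : W `<=` V j),
         res _ _ Wi (s i) = res _ _ Wj (s j)) ->
      exists! t : F U, forall i, res _ _ (VU i) t = s i.

Record ringedSpace := RingedSpace {
  points :> topologicalType;
  sections : opens points -> comPzRingType;
  restr : forall U V : opens points, V `<=` U ->
    {rmorphism sections U -> sections V};
  restr_id : forall (U : opens points) (UU : U `<=` U) s, restr UU s = s;
  restr_comp : forall (U V W : opens points) (VU : V `<=` U) (WV : W `<=` V)
    (WU : W `<=` U) s, restr WV (restr VU s) = restr WU s;
  restr_sheaf : sheaf_axiom (fun U V VU => restr VU : _ -> _) }.

Section Stalk.
Variables (X : ringedSpace) (x : X).

Record pregerm := PreGerm {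
  pregerm_open : opens X;
  pregerm_mem : open_set pregerm_open x;
  pregerm_sec : sections pregerm_open }.

HB.instance Definition _ := gen_eqMixin pregerm.
HB.instance Definition _ := gen_choiceMixin pregerm.

Definition same_germ (a b : pregerm) : bool :=
  `[< exists (W : opens X) (Wa : W `<=` pregerm_open a)
        (Wb : W `<=` pregerm_open b),
      open_set W x /\ restr Wa (pregerm_sec a) = restr Wb (pregerm_sec b) >].

Lemma same_germ_refl : reflexive same_germ.
Proof.
by move=> [U Ux s]; apply/asboolP; exists U, (fun _ => id), (fun _ => id).
Qed.

Lemma same_germ_sym : symmetric same_germ.
Proof.
by move=> a b; apply/asboolP/asboolP => -[W [Wa [Wb [Wx e]]]]; exists W, Wb, Wa.
Qed.

Lemma same_germ_trans : transitive same_germ.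
Proof.
move=> b a c /asboolP[V [Va [Vb [Vx eV]]]] /asboolP[W [Wb [Wc [Wx eW]]]].
have IV : opensI V W `<=` V by move=> y [].
have IW : opensI V W `<=` W by move=> y [].
apply/asboolP; exists (opensI V W), (subset_trans IV Va), (subset_trans IW Wc).
split; first by split.
rewrite -(restr_comp Va IV) eV -(restr_comp Wc IW) -eW.
by rewrite !(restr_comp _ _ (subset_trans IV Vb)).
Qed.

Canonical same_germ_equiv :=
  EquivRel same_germ same_germ_refl same_germ_sym same_germ_trans.

Definition stalk := {eq_quot same_germ}.
HB.instance Definition _ := Choice.on stalk.

Definition germ (U : opens X) (Ux : open_set U x) (s : sections U) : stalk :=
  \pi_stalk (PreGerm Ux s).

Lemma germP (U V : opens X) (Ux : open_set U x) (Vx : open_set V x)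
    (s : sections U) (t : sections V) :
  germ Ux s = germ Vx t <->
  exists (W : opens X) (WU : W `<=` U) (WV : W `<=` V),
    open_set W x /\ restr WU s = restr WV t.
Proof.
rewrite /germ; split; first by move=> /eqP; rewrite eqmodE => /asboolP.
by move=> e; apply/eqP; rewrite eqmodE; apply/asboolP.
Qed.

Lemma germ_restr (U V : opens X) (Ux : open_set U x) (Vx : open_set V x)
    (VU : V `<=` U) (s : sections U) : germ Vx (restr VU s) = germ Ux s.
Proof.
apply/germP; exists V, (fun _ => id), VU; split=> //.
by rewrite (restr_comp _ _ VU).
Qed.

Lemma germ_surj (a : stalk) :
  exists (U : opens X) (Ux : open_set U x) (s : sections U), a = germ Ux s.
Proof.
by elim/quotW: a => -[U Ux s]; exists U, Ux, s.
Qed.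

Lemma germ_surj2 (a b : stalk) :
  exists (U : opens X) (Ux : open_set U x) (s t : sections U),
    a = germ Ux s /\ b = germ Ux t.
Proof.
have [U [Ux [s ->]]] := germ_surj a; have [V [Vx [t ->]]] := germ_surj b.
have IU : opensI U V `<=` U by move=> y [].
have IV : opensI U V `<=` V by move=> y [].
have Ix : open_set (opensI U V) x by split.
by exists (opensI U V), Ix, (restr IU s), (restr IV t); rewrite !germ_restr.
Qed.

Lemma germ_surj3 (a b c : stalk) :
  exists (U : opens X) (Ux : open_set U x) (s t u : sections U),
    [/\ a = germ Ux s, b = germ Ux t & c = germ Ux u].
Proof.
have [U [Ux [s [t [-> ->]]]]] := germ_surj2 a b.
have [V [Vx [u ->]]] := germ_surj c.
have IU : opensI U V `<=` U by move=> y [].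
have IV : opensI U V `<=` V by move=> y [].
have Ix : open_set (opensI U V) x by split.
exists (opensI U V), Ix, (restr IU s), (restr IU t), (restr IV u).
by rewrite !germ_restr.
Qed.

Definition pregerm_op2 (op : forall U : opens X,
    sections U -> sections U -> sections U) (a b : pregerm) : pregerm :=
  PreGerm (pregerm_open := opensI (pregerm_open a) (pregerm_open b))
    (conj (pregerm_mem a) (pregerm_mem b))
    (op _ (restr (@opensIl _ _ _) (pregerm_sec a))
          (restr (@opensIr _ _ _) (pregerm_sec b))).

Definition stalk_op2 op (a b : stalk) : stalk :=
  \pi_stalk (pregerm_op2 op (repr a) (repr b)).

Definition stalk_zero : stalk := germ (U := opensT X) I 0.
Definition stalk_one : stalk := germ (U := opensT X) I 1.
Definition stalk_add := stalk_op2 (fun U => +%R).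
Definition stalk_mul := stalk_op2 (fun U => *%R).
Definition stalk_opp (a : stalk) : stalk :=
  germ (pregerm_mem (repr a)) (- pregerm_sec (repr a)).

Lemma stalk_op2E op (U : opens X) (Ux : open_set U x) (s t : sections U) :
  (forall (V W : opens X) (WV : W `<=` V) (a b : sections V),
     restr WV (op V a b) = op W (restr WV a) (restr WV b)) ->
  stalk_op2 op (germ Ux s) (germ Ux t) = germ Ux (op U s t).
Proof.
move=> opR; rewrite /stalk_op2 /germ.
case: (repr _) (reprK (germ Ux s)) => V Vx s' /germP[V1 [V1V [V1U [V1x es]]]].
case: (repr _) (reprK (germ Ux t)) => W Wx t' /germP[W1 [W1W [W1U [W1x et]]]].
apply/germP; exists (opensI V1 W1).
have I1 : opensI V1 W1 `<=` V1 by move=> y [].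
have I2 : opensI V1 W1 `<=` W1 by move=> y [].
have IVW : opensI V1 W1 `<=` opensI V W by move=> y [/V1V ? /W1W].
exists IVW, (subset_trans I1 V1U); split; first by split.
rewrite !opR /=; congr (op _ _ _).
  rewrite (restr_comp _ _ (subset_trans I1 V1V)).
  by rewrite -(restr_comp V1V I1) es (restr_comp _ _ (subset_trans I1 V1U)).
rewrite (restr_comp _ _ (subset_trans I2 W1W)).
by rewrite -(restr_comp W1W I2) et (restr_comp _ _ (subset_trans I1 V1U)).
Qed.

Lemma germD (U : opens X) (Ux : open_set U x) (s t : sections U) :
  stalk_add (germ Ux s) (germ Ux t) = germ Ux (s + t).
Proof. by rewrite /stalk_add stalk_op2E // => *; rewrite rmorphD. Qed.

Lemma germM (U : opens X) (Ux : open_set U x) (s t : sections U) :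
  stalk_mul (germ Ux s) (germ Ux t) = germ Ux (s * t).
Proof. by rewrite /stalk_mul stalk_op2E // => *; rewrite rmorphM. Qed.

Lemma germN (U : opens X) (Ux : open_set U x) (s : sections U) :
  stalk_opp (germ Ux s) = germ Ux (- s).
Proof.
rewrite /stalk_opp; case: (repr _) (reprK (germ Ux s)) => V Vx s'.
move=> /germP[W [WV [WU [Wx e]]]]; apply/germP.
by exists W, WV, WU; rewrite !rmorphN e.
Qed.

Lemma germ0 (U : opens X) (Ux : open_set U x) :
  stalk_zero = germ Ux (0 : sections U).
Proof.
apply/germP; exists U, (fun y _ => I), (fun _ => id).
by rewrite !rmorph0.
Qed.

Lemma germ1 (U : opens X) (Ux : open_set U x) :
  stalk_one = germ Ux (1 : sections U).
Proof.
apply/germP; exists U, (fun y _ => I), (fun _ => id).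
by rewrite !rmorph1.
Qed.

Lemma stalk_addA : associative stalk_add.
Proof.
move=> a b c; have [U [Ux [s [t [u [-> -> ->]]]]]] := germ_surj3 a b c.
by rewrite !germD addrA.
Qed.

Lemma stalk_addC : commutative stalk_add.
Proof.
move=> a b; have [U [Ux [s [t [-> ->]]]]] := germ_surj2 a b.
by rewrite !germD addrC.
Qed.

Lemma stalk_add0 : left_id stalk_zero stalk_add.
Proof.
by move=> a; have [U [Ux [s ->]]] := germ_surj a; rewrite (germ0 Ux) germD add0r.
Qed.

Lemma stalk_addN : left_inverse stalk_zero stalk_opp stalk_add.
Proof.
move=> a; have [U [Ux [s ->]]] := germ_surj a.
by rewrite germN germD addNr -germ0.
Qed.

HB.instance Definition _ := GRing.isZmodule.Build stalk
  stalk_addA stalk_addC stalk_add0 stalk_addN.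

Lemma stalk_mulA : associative stalk_mul.
Proof.
move=> a b c; have [U [Ux [s [t [u [-> -> ->]]]]]] := germ_surj3 a b c.
by rewrite !germM mulrA.
Qed.

Lemma stalk_mulC : commutative stalk_mul.
Proof.
move=> a b; have [U [Ux [s [t [-> ->]]]]] := germ_surj2 a b.
by rewrite !germM mulrC.
Qed.

Lemma stalk_mul1 : left_id stalk_one stalk_mul.
Proof.
by move=> a; have [U [Ux [s ->]]] := germ_surj a; rewrite (germ1 Ux) germM mul1r.
Qed.

Lemma stalk_mulDl : left_distributive stalk_mul +%R.
Proof.
move=> a b c; have [U [Ux [s [t [u [-> -> ->]]]]]] := germ_surj3 a b c.
by rewrite /GRing.add /= germD !germM germD mulrDl.
Qed.

HB.instance Definition _ := GRing.Zmodule_isComPzRing.Build stalk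
  stalk_mulA stalk_mulC stalk_mul1 stalk_mulDl.

End Stalk.

Record ringed_hom (X Y : ringedSpace) := RingedHom {
  hom_map :> X -> Y;
  hom_cont : continuous hom_map;
  hom_preim : opens Y -> opens X := fun V => Opens (open_preimage V hom_cont);
  hom_sec : forall V : opens Y,
    {rmorphism sections V -> sections (hom_preim V)};
  hom_natural : forall (V W : opens Y) (WV : W `<=` V)
      (WV' : hom_preim W `<=` hom_preim V) (s : sections V),
    hom_sec W (restr WV s) = restr WV' (hom_sec V s) }.

(* An isomorphism of ringed spaces from [spec R] to the open subspace [U] of
   [X].  The structure sheaf of [spec R] is the sheaf whose sections over the
   basic opens [D(g)] are the localizations of [R] away from [g], so such an
   isomorphism consists of a homeomorphism onto [U] and a ring morphism from
   [R] to the sections over [U] which makes the sections over the image of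
   each [D(g)] a localization of [R] away from [g]. *)
Record affine_chart (R : comPzRingType) (X : ringedSpace) (U : opens X) :=
  AffineChart {
    chart_map : spec R -> X;
    chart_inj : injective chart_map;
    chart_range : range chart_map = U;
    chart_open : forall A : set (spec R), open A <-> open (chart_map @` A);
    chart_ring : {rmorphism R -> sections U};
    chart_loc : forall (g : R) (W : opens X) (WU : W `<=` U),
      open_set W = chart_map @` basic_open g ->
      localization_away g (fun a => restr WU (chart_ring a)) }.

Definition affine_open (X : ringedSpace) (U : opens X) : Prop :=
  exists R : comPzRingType, inhabited (affine_chart R U).

Record scheme := Scheme {
  scheme_space :> ringedSpace;
  scheme_local : forall x : scheme_space, local_ring (stalk x);
  scheme_affine : forall x : scheme_space,
    exists U : opens scheme_space, open_set U x /\ affine_open U }.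

(* [scheme_hom_local]: the induced map on stalks sends the maximal ideal into
   the maximal ideal. *)
Record scheme_hom (X Y : scheme) := SchemeHom {
  ringed_of_hom :> ringed_hom X Y;
  scheme_hom_local : forall (x : X) (m : set (stalk x))
      (n : set (stalk (ringed_of_hom x))),
    maximal_ideal m -> maximal_ideal n ->
    forall (V : opens Y) (Vfx : open_set V (ringed_of_hom x))
      (s : sections V),
    n (germ Vfx s) ->
    m (germ (U := hom_preim ringed_of_hom V) Vfx (hom_sec ringed_of_hom V s)) }.

(* The triangle [X -> Y -> S], [X -> S] commutes.  The two preimages of [V] in
   [X] are equal but not convertible, so sections are compared on opens
   contained in both. *)
Definition hom_over (S X Y : ringedSpace) (pX : ringed_hom X S)
    (pY : ringed_hom Y S) (f : ringed_hom X Y) : Prop :=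
  (forall x, pY (f x) = pX x) /\
  forall (V : opens S) (s : sections V) (W : opens X)
    (W1 : W `<=` hom_preim f (hom_preim pY V)) (W2 : W `<=` hom_preim pX V),
  restr W1 (hom_sec f _ (hom_sec pY V s)) = restr W2 (hom_sec pX V s).

Definition locally_noetherian (X : scheme) : Prop :=
  forall x : X, exists (U : opens X) (R : comPzRingType),
    [/\ open_set U x, inhabited (affine_chart R U) & noetherian_ring R].

Definition normal_scheme (X : scheme) : Prop :=
  forall x : X, normal_domain (stalk x).

Definition quasi_compact (X Y : scheme) (f : scheme_hom X Y) : Prop :=
  forall V : opens Y, compact V -> compact (hom_preim f V).

Definition locally_of_finite_type (X Y : scheme) (f : scheme_hom X Y) : Prop :=
  forall x : X, exists (U : opens X) (V : opens Y) (UV : U `<=` hom_preim f V),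
    [/\ open_set U x, affine_open U, affine_open V
      & finite_type_hom (fun s => restr UV (hom_sec f V s))].

Definition of_finite_type (X Y : scheme) (f : scheme_hom X Y) : Prop :=
  quasi_compact f /\ locally_of_finite_type f.

Record omodule (X : ringedSpace) := OModule {
  msec : forall U : opens X, lmodType (sections U);
  mrestr : forall U V : opens X, V `<=` U -> {additive msec U -> msec V};
  mrestrZ : forall (U V : opens X) (VU : V `<=` U) a (w : msec U),
    mrestr VU (a *: w) = restr VU a *: mrestr VU w;
  mrestr_id : forall (U : opens X) (UU : U `<=` U) w, mrestr UU w = w;
  mrestr_comp : forall (U V W : opens X) (VU : V `<=` U) (WV : W `<=` V)
    (WU : W `<=` U) w, mrestr WV (mrestr VU w) = mrestr WU w;
  mrestr_sheaf : sheaf_axiom (fun U V VU => mrestr VU : _ -> _) }.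

Arguments mrestr {X o U V}.

Definition structure_omodule (X : ringedSpace) : omodule X :=
  @OModule X (fun U => (sections U)^o : lmodType (sections U))
    (fun U V VU => restr VU : {additive (sections U)^o -> (sections V)^o})
    (fun U V VU a s => rmorphM (restr VU) a s)
    (@restr_id X) (@restr_comp X) (@restr_sheaf X).

Record omodule_hom (X : ringedSpace) (E F : omodule X) := OModuleHom {
  ohom :> forall U : opens X, {linear msec E U -> msec F U};
  ohom_natural : forall (U V : opens X) (VU : V `<=` U) (w : msec E U),
    ohom V (mrestr VU w) = mrestr VU (ohom U w) }.

Section Differentials.
Variables (X Y : ringedSpace) (f : ringed_hom X Y).

(* [D] is an O_Y-linear derivation of the restriction of O_X to [U] with
   values in the restriction of [F] to [U].  Only the maps [D W] with [W]
   contained in [U] are constrained and meaningful; the other ones are junk. *)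
Definition derivation_on (U : opens X) (F : omodule X)
    (D : forall W : opens X, sections W -> msec F W) : Prop :=
  forall W : opens X, W `<=` U ->
  [/\ forall a b : sections W, D W (a + b) = D W a + D W b,
      forall a b : sections W, D W (a * b) = a *: D W b + b *: D W a,
      forall (V : opens Y) (WV : W `<=` hom_preim f V) (t : sections V)
        (a : sections W),
        D W (restr WV (hom_sec f V t) * a)
          = restr WV (hom_sec f V t) *: D W a
    & forall (W' : opens X) (W'W : W' `<=` W) (a : sections W),
        D W' (restr W'W a) = mrestr W'W (D W a)].

Definition tangent_section (U : opens X)
    (D : forall W : opens X, sections W -> sections W) : Prop :=
  derivation_on U (F := structure_omodule X) D.

(* [Omega], with its universal derivation [d], represents the functor
   F |-> Der_{O_Y}(O_X, F) on sheaves of O_X-modules. *)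
Definition is_differentials (Omega : omodule X)
    (d : forall W : opens X, sections W -> msec Omega W) : Prop :=
  derivation_on (opensT X) d /\
  forall (F : omodule X) (D : forall W : opens X, sections W -> msec F W),
    derivation_on (opensT X) D ->
    exists phi : omodule_hom Omega F,
      (forall W s, phi W (d W s) = D W s) /\
      forall psi : omodule_hom Omega F, (forall W s, psi W (d W s) = D W s) ->
        forall W w, psi W w = phi W w.

End Differentials.

Section Fitting.
Variables (X : ringedSpace) (E : omodule X).

(* Over [U], the sequence O^m -> O^n -> E -> 0 is an exact sequence of
   sheaves, where O^m -> O^n is right multiplication of row vectors by [M] and
   O^n -> E sends the canonical basis to [e]. *)
Definition presentation (U : opens X) m n (M : 'M[sections U]_(m, n))
    (e : 'I_n -> msec E U) : Prop :=
  [/\ forall i, \sum_j M i j *: e j = 0,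
      forall (V : opens X) (VU : V `<=` U) (a : 'rV[sections V]_n),
        \sum_j a 0 j *: mrestr VU (e j) = 0 ->
        forall x, open_set V x ->
        exists (W : opens X) (WV : W `<=` V) (WU : W `<=` U)
          (c : 'rV[sections W]_m),
          open_set W x /\
          map_mx (restr WV) a = c *m map_mx (restr WU) M
    & forall (V : opens X), V `<=` U -> forall (w : msec E V) x,
        open_set V x ->
        exists (W : opens X) (WV : W `<=` V) (WU : W `<=` U)
          (a : 'rV[sections W]_n),
          open_set W x /\
          mrestr WV w = \sum_j a 0 j *: mrestr WU (e j)].

(* Sections over [U] of the r-th Fitting ideal sheaf, generated on each open
   set where [E] has a presentation by the minors of order [n - r] (for
   [n <= r] the empty minor 1, so that the ideal is then the unit ideal); by
   Fitting's lemma it does not depend on the presentations. *)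
Definition fitting_ideal (r : nat) (U : opens X) : set (sections U) :=
  [set s | forall x, open_set U x ->
     exists (W : opens X) (WU : W `<=` U) (m n : nat)
       (M : 'M[sections W]_(m, n)) (e : 'I_n -> msec E W),
     [/\ open_set W x, presentation M e
       & ideal_gen (minors M (n - r)%N) (restr WU s)]].

End Fitting.

Arguments fitting_ideal {X} E r U.

(* Main.v *)
(* A derivation D of O_X over O_Y, defined on U, acts on Omega|_U by a Lie
   derivative L, with L(d s) = d(D s) and L(a w) = D(a) w + a L(w).  It
   comes from the universal property, applied to the derivation
   s |-> d s + eps d(D s) into Omega + eps Omega|_U, where a function a acts as
   a + eps D(a).  If M is a matrix of relations between local generators e_j and
   L(e) = B e, then applying L to M e = 0 shows that the rows of D(M) + M B are
   relations, so D(M) = C M - M B, which forces D to preserve the ideals of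
   minors of M. *)
From HB Require Import structures.
Require Import Defs.
From mathcomp Require Import all_boot all_order all_algebra.
From mathcomp Require Import boolp classical_sets topology.

Import GRing.Theory.
Local Open Scope classical_set_scope.
Local Open Scope ring_scope.

Set Implicit Arguments.
Unset Strict Implicit.
Unset Printing Implicit Defensive.

(** * Ideals of minors and Laplace expansion *)

Section IdealGen.
Variable A : comPzRingType.
Implicit Types (I G : set A).

Lemma ideal_gen_ideal G : ideal (ideal_gen G).
Proof.
split=> [I [] // | a b Ga Gb I idI GI | a b Gb I idI GI].
  by have [_ ID _] := idI; apply: ID; [exact: Ga | exact: Gb].
by have [_ _ IM] := idI; apply: IM; exact: Gb.
Qed.

Lemma sub_ideal_gen G : G `<=` ideal_gen G.
Proof. by move=> a Ga I _; exact. Qed.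

Lemma ideal_sum I (T : finType) (F : T -> A) :
  ideal I -> (forall t, I (F t)) -> I (\sum_t F t).
Proof. by move=> [I0 ID _] IF; apply: big_ind. Qed.

Lemma idealN I a : ideal I -> I a -> I (- a).
Proof. by move=> [_ _ IM] Ia; rewrite -mulN1r; exact: IM. Qed.

(** A repeated row or column makes the determinant vanish, so the injectivity demanded by [minors]
    costs nothing. This matters because replacing one index of a minor may create a repetition. *)
Lemma minors_ideal_gen m n p (M : 'M[A]_(m, n)) (f : 'I_p -> 'I_m)
    (g : 'I_p -> 'I_n) : ideal_gen (minors M p) (\det (mxsub f g M)).
Proof.
have zero : ideal_gen (minors M p) 0 by case: (ideal_gen_ideal (minors M p)).
have [/fintype.injectiveP fI|/fintype.injectivePn[i [i' ii' fii']]] :=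
    boolP (injectiveb f); last first.
  by rewrite (determinant_alternate ii') // => j; rewrite !mxE fii'.
have [/fintype.injectiveP gI|/fintype.injectivePn[j [j' jj' gjj']]] :=
    boolP (injectiveb g); last first.
  rewrite -det_tr (determinant_alternate jj') // => i.
  by rewrite !mxE gjj'.
by apply: sub_ideal_gen; exists f, g.
Qed.

(** Cofactors along row [i] do not see row [i], so the left side is the Laplace expansion of the
    minor in which that row is taken from row [k] of [M]. *)
Lemma det_mxsub_row m n p (M : 'M[A]_(m, n)) (f : 'I_p -> 'I_m)
    (g : 'I_p -> 'I_n) (i : 'I_p) (k : 'I_m) :
  \sum_j M k (g j) * cofactor (mxsub f g M) i j
    = \det (mxsub [eta f with i |-> k] g M).
Proof.
rewrite (expand_det_row _ i); apply: eq_bigr => j _.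
rewrite mxE /= eqxx; congr (_ * (_ * _)).
congr determinant; apply/matrixP=> a b.
by rewrite !mxE /= eq_sym (negPf (neq_lift _ _)).
Qed.

Lemma det_mxsub_col m n p (M : 'M[A]_(m, n)) (f : 'I_p -> 'I_m)
    (g : 'I_p -> 'I_n) (j : 'I_p) (k : 'I_n) :
  \sum_i M (f i) k * cofactor (mxsub f g M) i j
    = \det (mxsub f [eta g with j |-> k] M).
Proof.
rewrite (expand_det_col _ j); apply: eq_bigr => i _.
rewrite mxE /= eqxx; congr (_ * (_ * _)).
congr determinant; apply/matrixP=> a b.
by rewrite !mxE /= [_ == j]eq_sym (negPf (neq_lift _ _)).
Qed.

End IdealGen.

(** The preimage of an ideal under a ring morphism is an ideal, so it suffices to look at
    generators. *)
Lemma ideal_gen_morph (A B : comPzRingType) (phi : {rmorphism A -> B})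
    (G : set A) (H : set B) a :
  phi @` G `<=` ideal_gen H -> ideal_gen G a -> ideal_gen H (phi a).
Proof.
move=> GH Ga; have [H0 HD HM] := ideal_gen_ideal H.
apply: (Ga (fun b => ideal_gen H (phi b))); last first.
  by move=> b Gb; apply: GH; exists b.
split=> [|b c Hb Hc|b c Hc]; first by rewrite rmorph0.
- by rewrite rmorphD; exact: HD.
- by rewrite rmorphM; exact: HM.
Qed.

Lemma minors_map m n p (A B : comPzRingType) (phi : {rmorphism A -> B})
    (M : 'M[A]_(m, n)) : phi @` minors M p `<=` minors (map_mx phi M) p.
Proof.
move=> _ [_ [f [g [fI gI ->]]] <-]; exists f, g; split=> //.
by rewrite -det_map_mx map_mxsub.
Qed.

(** * Derivations of determinants and of ideals of minors *)

Section Derivation.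
Variables (A : comPzRingType) (D : A -> A).
Hypothesis DD : forall a b, D (a + b) = D a + D b.
Hypothesis DM : forall a b, D (a * b) = a * D b + b * D a.

Lemma der0 : D 0 = 0.
Proof. by apply: (addIr (D 0)); rewrite -DD !add0r. Qed.

Lemma der1 : D 1 = 0.
Proof. by apply: (addIr (D 1)); rewrite -{3}(mulr1 1) DM !mul1r add0r. Qed.

Lemma derN a : D (- a) = - D a.
Proof. by apply: (addIr (D a)); rewrite -DD !addNr der0. Qed.

Lemma der_sum (T : Type) (s : seq T) (F : T -> A) :
  D (\sum_(t <- s) F t) = \sum_(t <- s) D (F t).
Proof. exact: (big_morph D DD der0). Qed.

Lemma der_prod p (F : 'I_p -> A) :
  D (\prod_i F i) = \sum_i \prod_j (if j == i then D (F j) else F j).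
Proof.
elim: p F => [|p IH] F; first by rewrite !big_ord0 der1.
rewrite big_ord_recl DM IH [RHS]big_ord_recl addrC; congr (_ + _).
  by rewrite big_ord_recl mulrC.
rewrite mulr_sumr; apply: eq_bigr => i _; rewrite big_ord_recl /=.
by congr (_ * _); apply: eq_bigr => j _; rewrite (inj_eq (@lift_inj _ _)).
Qed.

Lemma der_det p (N : 'M[A]_p) :
  D (\det N) = \sum_i \sum_j D (N i j) * cofactor N i j.
Proof.
(* [R i] is [N] with row [i] differentiated. Its expansion along that row gives the inner sum of the
   claim, and the Leibniz rule in each term of the permutation expansion gives the sum of the
   [\det (R i)]. *)
pose R i := \matrix_(a, b) (if a == i then D (N a b) else N a b).
transitivity (\sum_i \det (R i)); last first.
  apply: eq_bigr => i _; rewrite (expand_det_row _ i); apply: eq_bigr => j _.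
  rewrite mxE eqxx; congr (_ * (_ * _)).
  congr determinant; apply/matrixP=> a b.
  by rewrite !mxE eq_sym (negPf (neq_lift _ _)).
rewrite /determinant exchange_big der_sum /=; apply: eq_bigr => s _.
have -> a :
    D ((-1) ^+ perm.odd_perm s * a) = (-1) ^+ perm.odd_perm s * D a.
  by case: (perm.odd_perm s); rewrite ?expr1 ?expr0 ?mulN1r ?mul1r ?derN.
rewrite der_prod mulr_sumr; apply: eq_bigr => i _; congr (_ * _).
by apply: eq_bigr => j _; rewrite mxE.
Qed.

(** The elements of the ideal whose derivative also lies in it form an ideal: in
    [D (b * c) = b * D c + c * D b] both terms lie in the ideal as soon as [c] and [D c] do. *)
Lemma der_ideal_gen (G : set A) :
  (forall a, G a -> ideal_gen G (D a)) ->
  forall a, ideal_gen G a -> ideal_gen G (D a).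
Proof.
move=> GD a Ga; have [G0 GA GM] := ideal_gen_ideal G.
suff: (ideal_gen G `&` [set b | ideal_gen G (D b)]) a by case.
apply: Ga; last by move=> b Gb; split; [exact: sub_ideal_gen | exact: GD].
split=> [|b c [Gb Db] [Gc Dc]|b c [Gc Dc]].
- by split=> //=; rewrite der0.
- by split=> /=; rewrite ?DD; exact: GA.
- by split=> /=; [|rewrite DM [c * _]mulrC; apply: GA]; exact: GM.
Qed.

(* [D M = C M - M B] says that [M] is carried to a matrix with the same ideals
   of minors by the infinitesimal row and column operations [1 + C], [1 - B];
   each term of the derivative of a minor thus replaces one of its rows, or one
   of its columns, by a row or a column of [M]. *)
Lemma der_minors m n p (M : 'M[A]_(m, n)) (B : 'M[A]_n) (C : 'M[A]_m) :
  map_mx D M + M *m B = C *m M ->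
  forall a, ideal_gen (minors M p) a -> ideal_gen (minors M p) (D a).
Proof.
move=> eM; have idM := ideal_gen_ideal (minors M p); have [_ IA IM] := idM.
apply: der_ideal_gen => _ [f [g [_ _ ->]]]; rewrite der_det.
have DE i j : D (mxsub f g M i j) =
    \sum_k C (f i) k * M k (g j) - \sum_k B k (g j) * M (f i) k.
  move/matrixP/(_ (f i) (g j)): eM; rewrite !mxE => <-.
  by rewrite -[X in _ - X](eq_bigr _ (fun k _ => mulrC _ _)) addrK.
under eq_bigr do under eq_bigr do rewrite DE mulrBl !mulr_suml.
under eq_bigr do rewrite sumrB.
rewrite sumrB; apply: IA; last apply: (idealN idM).
- apply: (ideal_sum idM) => i; rewrite exchange_big; apply: ideal_sum => // k.
  under eq_bigr do rewrite -mulrA.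
  by rewrite -mulr_sumr det_mxsub_row; apply: IM; exact: minors_ideal_gen.
- rewrite exchange_big; apply: (ideal_sum idM) => j; rewrite exchange_big.
  apply: (ideal_sum idM) => k; under eq_bigr do rewrite -mulrA.
  by rewrite -mulr_sumr det_mxsub_col; apply: IM; exact: minors_ideal_gen.
Qed.

End Derivation.

(** * The twisted module [E + eps E|_U] *)

Lemma opensIS (X : topologicalType) (U V W : opens X) :
  V `<=` U -> opensI V W `<=` opensI U W.
Proof. by move=> VU x [/VU]. Qed.

Lemma opensI_sub (X : topologicalType) (U V : opens X) :
  U `<=` V -> U `<=` opensI U V.
Proof. by move=> UV x Ux; split; last exact: UV. Qed.

Section TangentSection.
Variables (X Y : ringedSpace) (f : ringed_hom X Y) (U : opens X).
Variable D : forall W : opens X, sections W -> sections W.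
Arguments D : clear implicits.
Hypothesis D_der : tangent_section f U D.

Lemma tangentD (W : opens X) : W `<=` U ->
  forall a b, D W (a + b) = D W a + D W b.
Proof. by move=> /D_der[]. Qed.

Lemma tangentM (W : opens X) : W `<=` U ->
  forall a b, D W (a * b) = a * D W b + b * D W a.
Proof. by move=> /D_der[]. Qed.

Lemma tangent_restr (W : opens X) (WU : W `<=` U) (W' : opens X)
    (W'W : W' `<=` W) a :
  D W' (restr W'W a) = restr W'W (D W a).
Proof. by have [_ _ _] := D_der WU; apply. Qed.

Lemma tangent_hom_sec (W : opens X) (WU : W `<=` U) (V : opens Y)
    (WV : W `<=` hom_preim f V) t : D W (restr WV (hom_sec f V t)) = 0.
Proof.
have [_ _ DY _] := D_der WU.
by rewrite -[restr WV _]mulr1 DY (der1 (tangentM WU)) scaler0.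
Qed.

Section Twist.
Variable E : omodule X.

(* The scaling depends on the tangent section, which is therefore a parameter
   of the type: it is from the type that module structures are inferred. *)
Definition twist (_ : tangent_section f U D) (W : opens X) : Type :=
  (msec E W * msec E (opensI W U))%type.

Section TwistModule.
Variable W : opens X.
Let UI : opensI W U `<=` U := @opensIr _ W U.
Let WI : opensI W U `<=` W := @opensIl _ W U.

HB.instance Definition _ := GRing.Zmodule.copy (twist D_der W)
  (msec E W * msec E (opensI W U))%type.

(** The product of [a + eps D a] and [w.1 + eps w.2] with [eps^2 = 0]. The [eps] part lives over the
    intersection of [W] and [U], since [D] is only meaningful inside [U]. *)
Definition twist_scale (a : sections W) (w : twist D_der W) : twist D_der W :=
  (a *: w.1, D _ (restr WI a) *: mrestr WI w.1 + restr WI a *: w.2).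

Lemma twist_scaleA a b w :
  twist_scale a (twist_scale b w) = twist_scale (a * b) w.
Proof.
congr pair; rewrite /= ?scalerA // rmorphM (tangentM UI) mrestrZ.
rewrite scalerDr !scalerA addrA scalerDl [X in _ = X + _]addrC.
by rewrite [D _ _ * restr _ b]mulrC.
Qed.

Lemma twist_scale1 : left_id 1 twist_scale.
Proof.
move=> [w w']; congr pair; rewrite /= ?scale1r // rmorph1.
by rewrite (der1 (tangentM UI)) scale0r add0r scale1r.
Qed.

Lemma twist_scaleDr : right_distributive twist_scale +%R.
Proof.
move=> a [w w'] [v v']; congr pair; rewrite /= ?scalerDr // raddfD scalerDr.
exact: addrACA.
Qed.

Lemma twist_scaleDl w : {morph twist_scale^~ w : a b / a + b}.
Proof.
move=> a b; congr pair; rewrite /= ?scalerDl // rmorphD (tangentD UI).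
by rewrite !scalerDl; exact: addrACA.
Qed.

HB.instance Definition _ := GRing.Zmodule_isLmodule.Build (sections W)
  (twist D_der W) twist_scaleA twist_scale1 twist_scaleDr twist_scaleDl.

End TwistModule.

Definition twist_restr (W V : opens X) (VW : V `<=` W) (w : twist D_der W) :
    twist D_der V :=
  (mrestr VW w.1, mrestr (@opensIS _ W V U VW) w.2).

Lemma twist_restrB (W V : opens X) (VW : V `<=` W) :
  zmod_morphism (twist_restr VW).
Proof. by move=> w v; congr pair; exact: raddfB. Qed.

HB.instance Definition _ (W V : opens X) (VW : V `<=` W) :=
  GRing.isZmodMorphism.Build (twist D_der W) (twist D_der V) (twist_restr VW)
    (twist_restrB VW).

Lemma twist_restrZ (W V : opens X) (VW : V `<=` W) a (w : twist D_der W) :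
  twist_restr VW (a *: w) = restr VW a *: twist_restr VW w.
Proof.
congr pair => /=; first exact: mrestrZ.
rewrite raddfD !mrestrZ -(tangent_restr (@opensIr _ W U)).
rewrite !(restr_comp _ _ (subset_trans (@opensIl _ V U) VW)).
by rewrite !(mrestr_comp _ _ (subset_trans (@opensIl _ V U) VW)).
Qed.

Lemma twist_restr_id (W : opens X) (WW : W `<=` W) (w : twist D_der W) :
  twist_restr WW w = w.
Proof. by case: w => w w'; rewrite /twist_restr !mrestr_id. Qed.

Lemma twist_restr_comp (W V T : opens X) (VW : V `<=` W) (TV : T `<=` V)
  (TW : T `<=` W) (w : twist D_der W) :
  twist_restr TV (twist_restr VW w) = twist_restr TW w.
Proof. by congr pair; exact: mrestr_comp. Qed.

(** Restriction acts componentwise, so the two components glue separately, the second along the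
    cover of [opensI W U] by the [opensI (V i) U]. *)
Lemma twist_sheaf : sheaf_axiom (fun W V VW => @twist_restr W V VW).
Proof.
move=> I W V VW cover s s_glue.
have [|w [ws w_uniq]] := @mrestr_sheaf _ E I W V VW cover (fun i => (s i).1).
  by move=> i j T Ti Tj; have [] := s_glue i j T Ti Tj.
pose VWU i := @opensIS _ W (V i) U (VW i).
have coverU : opensI W U `<=` \bigcup_i opensI (V i) U.
  by move=> x [/cover[i _ Vix] Ux]; exists i.
have [|w' [w's w'_uniq]] :=
    @mrestr_sheaf _ E I _ _ VWU coverU (fun i => (s i).2).
  move=> i j T Ti Tj.
  have Ti' := subset_trans Ti (@opensIl _ _ _).
  have Tj' := subset_trans Tj (@opensIl _ _ _).
  (* The hypothesis compares second components over [opensI T U]; as [T] lies in [U], restricting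
     them to [T] gives the required equality. *)
  have TU := opensI_sub (subset_trans Ti (@opensIr _ _ _)).
  have [_] := s_glue i j T Ti' Tj'.
  by move=> /(congr1 (mrestr TU)); rewrite !mrestr_comp.
exists (w, w'); split=> [i|[v v'] vs].
  by rewrite [RHS]surjective_pairing -ws -w's.
congr pair.
  by apply: w_uniq => i; rewrite -vs.
by apply: w'_uniq => i; rewrite -vs.
Qed.

Definition twist_omodule : omodule X :=
  @OModule X (fun W => twist D_der W)
    (fun W V VW => @twist_restr W V VW : {additive _ -> _})
    twist_restrZ twist_restr_id twist_restr_comp twist_sheaf.

End Twist.
End TangentSection.

(** * The Lie derivative on differentials *)

Section Lie.
Variables (X Y : ringedSpace) (f : ringed_hom X Y) (U : opens X).
Variable D : forall W : opens X, sections W -> sections W.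
Arguments D : clear implicits.
Hypothesis D_der : tangent_section f U D.
Variable Omega : omodule X.
Variable d : forall W : opens X, sections W -> msec Omega W.
Arguments d : clear implicits.

(** Expanding [d (D (a * b))] by both Leibniz rules produces the cross terms [D a *: d b] and
    [D b *: d a], which are exactly those of the twisted scaling. Linearity over O_Y holds because
    [D] kills functions pulled back from [Y]. *)
Lemma twist_derivation : derivation_on f (opensT X) d ->
  derivation_on f (opensT X) (F := twist_omodule D_der Omega)
    (fun W s => (d W s, d _ (D _ (restr (@opensIl _ W U) s)))).
Proof.
move=> d_der W WT; pose WI := @opensIl _ W U; pose UI := @opensIr _ W U.
have [dD dM dY dR] := d_der W WT.
have [dID dIM dIY dIR] := d_der (opensI W U) (fun _ _ => I).
split=> [a b|a b|V WV t a|W' W'W a]; congr pair => //=.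
- by rewrite rmorphD (tangentD D_der UI) dID.
- rewrite rmorphM (tangentM D_der UI) dID !dIM -!dR.
  by rewrite [X in _ + X = _]addrC addrACA [X in X + _ = _]addrC.
- have [_ _ DY _] := D_der UI; rewrite rmorphM.
  rewrite (restr_comp WV WI (subset_trans WI WV)).
  by rewrite (tangent_hom_sec D_der UI) scale0r add0r DY dIY.
- rewrite -dIR -(tangent_restr D_der UI).
  by rewrite !(restr_comp _ _ (subset_trans (@opensIl _ W' U) W'W)).
Qed.

Section TwistFst.
Variable phi : omodule_hom Omega (twist_omodule D_der Omega).

(** The twisted scaling is the ordinary one on first components, so this is an endomorphism of
    [Omega], which can be compared with the identity. *)
Definition twist_fst (W : opens X) (w : msec Omega W) : msec Omega W :=
  (phi W w).1.

Lemma twist_fst_linear (W : opens X) : linear (@twist_fst W).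
Proof. by move=> a v w; rewrite /twist_fst linearP. Qed.

HB.instance Definition _ (W : opens X) :=
  GRing.isLinear.Build (sections W) (msec Omega W) (msec Omega W) *:%R
    (@twist_fst W) (@twist_fst_linear W).

Definition twist_fst_hom : omodule_hom Omega Omega :=
  @OModuleHom X Omega Omega (fun W => @twist_fst W : {linear _ -> _})
    (fun V W VW w => congr1 fst (ohom_natural phi VW w)).

End TwistFst.

Definition omodule_id : omodule_hom Omega Omega :=
  @OModuleHom X Omega Omega
    (fun W => idfun : {linear msec Omega W -> msec Omega W})
    (fun V W VW w => erefl).

Lemma lie_derivative : is_differentials f d ->
  exists L : forall W : opens X, W `<=` U -> msec Omega W -> msec Omega W,
  [/\ forall (W : opens X) (WU : W `<=` U), {morph L W WU : v w / v + w},
      forall (W : opens X) (WU : W `<=` U) a w,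
        L W WU (a *: w) = D W a *: w + a *: L W WU w
    & forall (W W' : opens X) (WU : W `<=` U) (W'U : W' `<=` U)
        (W'W : W' `<=` W) w,
        L W' W'U (mrestr W'W w) = mrestr W'W (L W WU w)].
Proof.
move=> [d_der d_univ].
have [phi [phi_d _]] := d_univ _ _ (twist_derivation d_der).
(* The first component of [phi] and the identity both send [d s] to [d s], so the uniqueness in the
   universal property of [d] identifies them. *)
have phi1 W w : (phi W w).1 = w.
  have [psi [_ psi_uniq]] := d_univ _ _ d_der.
  rewrite -[RHS]/(omodule_id W w) -[LHS]/(twist_fst_hom phi W w).
  rewrite (psi_uniq (twist_fst_hom phi)) ?(psi_uniq omodule_id) // => V s.
  by rewrite /= /twist_fst phi_d.
(* [L] is the [eps] component of [phi], moved from [opensI W U] to [W]. Its Leibniz rule is the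
   linearity of [phi] for the twisted scaling, read with [phi1]. *)
exists (fun W WU w => mrestr (opensI_sub WU) (phi W w).2).
split=> [W WU v w|W WU a w|W W' WU W'U W'W w].
- by rewrite linearD /= raddfD.
- rewrite linearZ /= raddfD !mrestrZ phi1.
  rewrite -(tangent_restr D_der (@opensIr _ W U)).
  rewrite !(restr_comp _ _ (fun _ => id)) !restr_id.
  by rewrite (mrestr_comp _ _ (fun _ => id)) mrestr_id.
- rewrite ohom_natural /=.
  by rewrite !(mrestr_comp _ _ (subset_trans W'W (opensI_sub WU))).
Qed.
End Lie.

(** * Local presentations and shrinking of open sets *)

(** A finite intersection of neighbourhoods is a neighbourhood. This turns the coefficients that a
    presentation yields for one section or relation at a time into a matrix over a common open
    set. *)
Lemma opens_shrink_all (X : topologicalType) (x : X) (V : opens X) (n : nat)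
    (P : 'I_n -> opens X -> Prop) :
  open_set V x ->
  (forall i (W W' : opens X), W' `<=` W -> P i W -> P i W') ->
  (forall i, exists W : opens X, [/\ W `<=` V, open_set W x & P i W]) ->
  exists W : opens X, [/\ W `<=` V, open_set W x & forall i, P i W].
Proof.
move=> Vx P_sub; elim: n P P_sub => [|n IH] P P_sub P_ex.
  by exists V; split=> // -[].
have [W [WV Wx PW]] := IH (fun i => P (lift ord0 i)) (fun i => P_sub _)
  (fun i => P_ex _).
have [T [TV Tx PT]] := P_ex ord0.
exists (opensI W T); split=> [y [/WV]//||i]; first by [].
have [j ->|->] := unliftP ord0 i.
  by apply: P_sub (PW j); exact: opensIl.
by apply: P_sub PT; exact: opensIr.
Qed.

Lemma mrestr_lincomb (X : ringedSpace) (E : omodule X) (V W : opens X)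
    (WV : W `<=` V) n (a : 'I_n -> sections V) (e : 'I_n -> msec E V) :
  mrestr WV (\sum_j a j *: e j) = \sum_j restr WV (a j) *: mrestr WV (e j).
Proof. by rewrite raddf_sum; apply: eq_bigr => j _; rewrite mrestrZ. Qed.

Section Presentation.
Variables (X : ringedSpace) (E : omodule X) (U : opens X) (m n : nat).
Variables (M : 'M[sections U]_(m, n)) (e : 'I_n -> msec E U).
Hypothesis pres : presentation M e.

Lemma presentation_restr (V : opens X) (VU : V `<=` U) :
  presentation (map_mx (restr VU) M) (fun j => mrestr VU (e j)).
Proof.
have [rel0 rel gen] := pres; split=> [i|W WV a|W WV w x Wx].
- under eq_bigr do rewrite mxE.
  by rewrite -mrestr_lincomb rel0 raddf0.
- under eq_bigr do rewrite (mrestr_comp _ _ (subset_trans WV VU)).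
  move=> a0 x Wx; have [T [TW [TU [c [Tx eT]]]]] := rel _ _ a a0 x Wx.
  exists T, TW, (subset_trans TW WV), c; split=> //.
  rewrite eT; congr (_ *m _); apply/matrixP=> i j; rewrite !mxE.
  by rewrite (restr_comp _ _ TU).
- have [T [TW [TU [a [Tx eT]]]]] := gen W (subset_trans WV VU) w x Wx.
  exists T, TW, (subset_trans TW WV), a; split=> //.
  rewrite eT; apply: eq_bigr => j _.
  by rewrite (mrestr_comp _ _ TU).
Qed.

Lemma presentation_gen x k (w : 'I_k -> msec E U) : open_set U x ->
  exists (W : opens X) (WU : W `<=` U) (a : 'M[sections W]_(k, n)),
    open_set W x /\
    forall i, mrestr WU (w i) = \sum_j a i j *: mrestr WU (e j).
Proof.
move=> Ux; have [_ _ gen] := pres.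
(* The inclusion is quantified inside [P] because [W] varies; proof irrelevance later makes all rows
   use the same one. *)
pose P i (W : opens X) := exists (WU : W `<=` U) (a : 'I_n -> sections W),
  mrestr WU (w i) = \sum_j a j *: mrestr WU (e j).
have [||W [WU Wx PW]] := @opens_shrink_all _ x U _ P Ux.
- move=> i W W' W'W [WU [a ea]].
  exists (subset_trans W'W WU), (fun j => restr W'W (a j)).
  rewrite -(mrestr_comp WU W'W) ea mrestr_lincomb.
  by apply: eq_bigr => j _; rewrite (mrestr_comp _ _ (subset_trans W'W WU)).
- move=> i; have [W [WU [WU' [a [Wx ea]]]]] := gen U (fun _ => id) (w i) x Ux.
  exists W; split=> //; exists WU', (a 0).
  by rewrite -ea (Prop_irrelevance WU' WU).
have /choice[a ea] : forall i, exists a : 'I_n -> sections W,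
    mrestr WU (w i) = \sum_j a j *: mrestr WU (e j).
  move=> i; have [WU' [a ea]] := PW i; exists a.
  by rewrite (Prop_irrelevance WU WU').
exists W, WU, (\matrix_(i, j) a i j); split=> // i.
by rewrite ea; apply: eq_bigr => j _; rewrite mxE.
Qed.

Lemma presentation_rel x k (a : 'M[sections U]_(k, n)) : open_set U x ->
  (forall i, \sum_j a i j *: e j = 0) ->
  exists (W : opens X) (WU : W `<=` U) (c : 'M[sections W]_(k, m)),
    open_set W x /\ map_mx (restr WU) a = c *m map_mx (restr WU) M.
Proof.
move=> Ux a0; have [_ rel _] := pres.
pose P i (W : opens X) := exists (WU : W `<=` U) (c : 'rV[sections W]_m),
  map_mx (restr WU) (row i a) = c *m map_mx (restr WU) M.
have [||W [WU Wx PW]] := @opens_shrink_all _ x U _ P Ux.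
- move=> i W W' W'W [WU [c ec]].
  exists (subset_trans W'W WU), (map_mx (restr W'W) c).
  have restrE q (N : 'M_(q, n)) : map_mx (restr (subset_trans W'W WU)) N =
      map_mx (restr W'W) (map_mx (restr WU) N).
    by apply/matrixP=> s t; rewrite !mxE (restr_comp _ _ (subset_trans W'W WU)).
  by rewrite !restrE ec map_mxM.
- move=> i; have [|W [WU [WU' [c [Wx ec]]]]] :=
    rel U (fun _ => id) (row i a) _ x Ux.
    by under eq_bigr do rewrite mxE mrestr_id.
  exists W; split=> //; exists WU', c.
  by rewrite -ec (Prop_irrelevance WU' WU).
have /choice[c ec] : forall i, exists c : 'rV[sections W]_m,
    map_mx (restr WU) (row i a) = c *m map_mx (restr WU) M.
  move=> i; have [WU' [c ec]] := PW i; exists c.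
  by rewrite (Prop_irrelevance WU WU').
exists W, WU, (\matrix_i c i); split=> //.
by apply/row_matrixP=> i; rewrite -map_row row_mul rowK ec.
Qed.

End Presentation.

(** * Stability of the Fitting ideals *)

Lemma ideal_gen_minors_restr (X : ringedSpace) (U V : opens X) (VU : V `<=` U)
    m n p (M : 'M[sections U]_(m, n)) s :
  ideal_gen (minors M p) s ->
  ideal_gen (minors (map_mx (restr VU) M) p) (restr VU s).
Proof.
apply: ideal_gen_morph => t Mt.
by apply: sub_ideal_gen; exact: minors_map Mt.
Qed.

Theorem lemma5p13 (k : fieldType) (char_k : [pchar k] =i pred0)
    (S : scheme) (S_spec_k : affine_chart k (opensT S))
    (X Y : scheme) (pX : scheme_hom X S) (pY : scheme_hom Y S)
    (X_ft : of_finite_type pX) (Y_ft : of_finite_type pY)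
    (X_noeth : locally_noetherian X) (Y_noeth : locally_noetherian Y)
    (X_normal : normal_scheme X) (Y_normal : normal_scheme Y)
    (f : scheme_hom X Y) (f_over_k : hom_over pX pY f)
    (Omega : omodule X) (d : forall W : opens X, sections W -> msec Omega W)
    (Omega_d : is_differentials f d)
    (r : nat) (U : opens X)
    (D : forall W : opens X, sections W -> sections W)
    (D_der : tangent_section f U D) :
  forall V : opens X, V `<=` U ->
    D V @` fitting_ideal Omega r V `<=` fitting_ideal Omega r V.
Proof.
move=> V VU _ [s s_fitt <-] x Vx.
have [W [WV [m [n [M [e [Wx pres Ms]]]]]]] := s_fitt x Vx.
have [L [LD LZ Lr]] := lie_derivative D_der Omega_d.
have L0 (T : opens X) (TU : T `<=` U) : L T TU 0 = 0.
  by apply: (addIr (L T TU 0)); rewrite -LD !add0r.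
have WU := subset_trans WV VU.
(* [B] is the matrix of [L] on the generators: near [x], [L(e) = B e]. *)
have [W1 [W1W [B [W1x LB]]]] := presentation_gen pres (L W WU \o e) Wx.
have W1U := subset_trans W1W WU.
set M1 := map_mx (restr W1W) M.
have pres1 : presentation M1 _ := presentation_restr pres W1W.
(* The Leibniz rule for [L] identifies the left side with [L] applied to the relation [M1 e = 0]. *)
have rel1 i : \sum_j (map_mx (D W1) M1 + M1 *m B) i j *: mrestr W1W (e j) = 0.
  have [/(_ i) M1e _ _] := pres1.
  transitivity (L W1 W1U (\sum_j M1 i j *: mrestr W1W (e j))); last first.
    by rewrite M1e L0.
  rewrite (big_morph _ (LD W1 W1U) (L0 W1 W1U)).
  under [LHS]eq_bigr do rewrite mxE scalerDl.
  under [RHS]eq_bigr do rewrite LZ (Lr _ _ WU) LB scaler_sumr.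
  rewrite !big_split /=; congr (_ + _).
    by apply: eq_bigr => j _; rewrite mxE.
  rewrite [RHS]exchange_big; apply: eq_bigr => j _.
  by rewrite mxE scaler_suml; apply: eq_bigr => l _; rewrite scalerA.
(* By exactness, these relations are combinations of the rows of [M1] on a smaller neighbourhood of
   [x]; [C] holds the coefficients. *)
have [W2 [W2W1 [C [W2x eC]]]] := presentation_rel pres1 W1x rel1.
have W2U := subset_trans W2W1 W1U.
have W2V := subset_trans W2W1 (subset_trans W1W WV).
exists W2, W2V, m, n, (map_mx (restr W2W1) M1).
exists (fun j => mrestr W2W1 (mrestr W1W (e j))).
split=> //; first exact: presentation_restr.
(* [D] commutes with restriction, so the claim concerns [D] of the restriction of [s] to [W2], where
   the matrix identity for [der_minors] is available. *)
rewrite -(tangent_restr D_der VU).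
apply: (der_minors (tangentD D_der W2U) (tangentM D_der W2U)
  (B := map_mx (restr W2W1) B) (C := C)).
  rewrite -eC map_mxD map_mxM; congr (_ + _).
  by apply/matrixP=> i j; rewrite !mxE (tangent_restr D_der W1U).
rewrite -(restr_comp (subset_trans W1W WV) W2W1) -(restr_comp WV W1W).
by do 2 apply: ideal_gen_minors_restr.
Qed.
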